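(* Let $s\in\mathbb{N}$ and $B,G\in\mathbb{R}^{s\times s}$. Let $W,Z\in\mathbb{R}^{s\times s}$ be symmetric positive definite matrices such that $$\mathbb{M}:=\begin{pmatrix} G^{\sf T}Z+ZG-W & -G^{\sf T}ZB\\ -B^{\sf T}ZG & W\end{pmatrix}$$ is positive semi-definite. Then the stability matrix $\mathbf{M}(z)=(I-zG)^{-1}B$ satisfies $$\|W^{1/2}\mathbf{M}(z)W^{-1/2}\|_2\le 1\qquad\text{for all } z\in\mathbb{C}\text{ with }\Re z<0.$$
   Context: $\|\cdot\|_2$ is the spectral norm and $W^{1/2}$ the symmetric positive definite square root of $W$. The matrix $\mathbf{M}(z)$ is the stability matrix of the stiffly accurate peer two-step method $Y_m-hGF_m=BY_{m-1}$ (with coefficient $A=0$) applied to $y'=\lambda y$, $z=h\lambda$. *)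

(* Defs.v *)
From HB Require Import structures.
From mathcomp Require Import all_boot all_order all_algebra.
From mathcomp Require Import boolp classical_sets reals.
From mathcomp Require Import sesquilinear spectral complex.

Set Implicit Arguments.
Unset Strict Implicit.
Unset Printing Implicit Defensive.

Import Order.TTheory GRing.Theory Num.Theory.
Local Open Scope ring_scope.

Notation toC A := (map_mx (real_complex _) A).

Definition psdmx (R : realType) (n : nat) (A : 'M[R]_n) : Prop :=
  A \is symmetricmx /\ forall x : 'cV[R]_n, 0 <= (x^T *m A *m x) 0 0.

Definition spdmx (R : realType) (n : nat) (A : 'M[R]_n) : Prop :=
  A \is symmetricmx /\
  forall x : 'cV[R]_n, x != 0 -> 0 < (x^T *m A *m x) 0 0.

(* The choice is determined when W is SPD: see [sqrtmxP] and [sqrtmx_unique]. *)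
Definition sqrtmx (R : realType) (n : nat) (W : 'M[R]_n) : 'M[R]_n :=
  xget 0 [set V : 'M[R]_n | spdmx V /\ V *m V = W]%classic.

Definition cvnorm2 (R : realType) (n : nat) (v : 'cV[R[i]]_n) : R :=
  Num.sqrt (\sum_i ComplexField.Normc.normc (v i 0) ^+ 2).

(* The norm induced by the Euclidean norm; the supremum exists, see
   [specnorm_has_sup]. *)
Definition specnorm (R : realType) (m n : nat) (A : 'M[R[i]]_(m, n)) : R :=
  sup [set cvnorm2 (A *m v) | v in [set v : 'cV[R[i]]_n | cvnorm2 v <= 1]]%classic.

(* [invmx A] is [A] itself when A is singular. *)
Definition stabmx (R : realType) (s : nat) (B G : 'M[R]_s) (z : R[i])
  : 'M[R[i]]_s := invmx (1%:M - z *: toC G) *m toC B.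

Section SqrtUnique.
Variables (K : numFieldType) (th : {rmorphism K -> K}).
Local Notation "A ^h" := (map_mx th (A^T)) (at level 30).

Lemma sqrt_unique_gen (n : nat) (S T : 'M[K]_n) : (S - T)^h = S - T ->
  (forall x : 'cV[K]_n, x != 0 -> 0 < (x^h *m S *m x) 0 0) ->
  (forall x : 'cV[K]_n, x != 0 -> 0 < (x^h *m T *m x) 0 0) ->
  S *m S = T *m T -> S = T.
Proof.
move=> Dh pS pT ST; apply/eqP; rewrite -subr_eq0.
apply: contraT => /matrix0Pn [i [j Dij]].
set D := S - T in Dh Dij *.
have e0 : S *m D + D *m T = 0.
  by rewrite /D mulmxBr mulmxBl ST addrA subrK subrr.
have trE (A : 'M[K]_n) :
    \tr (D *m A *m D) = \sum_k ((col k D)^h *m A *m col k D) 0 0.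
  apply: eq_bigr => k _.
  rewrite -[X in X *m A]Dh !mxE; apply: eq_bigr => l _; rewrite !mxE.
  by congr (_ * _); apply: eq_bigr => q _; rewrite !mxE.
have : \tr (D *m S *m D) + \tr (D *m T *m D) = 0.
  by rewrite [X in _ + X]mxtrace_mulC -mxtraceD -mulmxA -mulmxDr e0 mulmx0 mxtrace0.
rewrite !trE => e; suff : 0 < 0 :> K by rewrite ltxx.
have ge0 (A : 'M[K]_n) : (forall x : 'cV[K]_n, x != 0 ->
    0 < (x^h *m A *m x) 0 0) -> forall x : 'cV[K]_n, 0 <= (x^h *m A *m x) 0 0.
  move=> pA x; have [->|/pA/ltW//] := eqVneq x 0.
  by rewrite mulmx0 mxE.
rewrite -{2}e ltr_wpDr ?sumr_ge0// => [k _|]; first exact: ge0.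
rewrite (bigD1 j)//= ltr_wpDr ?sumr_ge0// => [k _|]; first exact: ge0.
by apply: pS; apply/matrix0Pn; exists i, 0; rewrite mxE.
Qed.
End SqrtUnique.

Lemma sqrtmx_unique (R : realType) (n : nat) (S T : 'M[R]_n) :
  spdmx S -> spdmx T -> S *m S = T *m T -> S = T.
Proof.
move=> [symS pS] [symT pT].
have h (A : 'M[R]_n) : A \is symmetricmx -> A^T = A.
  by move=> /is_hermitianmxP; rewrite expr0 scale1r map_mx_id.
apply: (@sqrt_unique_gen R (idfun : {rmorphism R -> R})).
- by rewrite map_mx_id// linearB/= !h.
- by move=> x; rewrite map_mx_id//; exact: pS.
- by move=> x; rewrite map_mx_id//; exact: pT.
Qed.

Section SqrtExists.
Local Open Scope sesquilinear_scope.

Local Notation cj := (map_mx Num.conj).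

Let cpd (C : numClosedFieldType) (n : nat) (A : 'M[C]_n) : Prop :=
  forall x : 'cV[C]_n, x != 0 -> 0 < (x^t* *m A *m x) 0 0.

Let quadE (C : numClosedFieldType) (n : nat) (P A : 'M[C]_n) (x : 'cV[C]_n) :
  x^t* *m (P^t* *m A *m P) *m x = (P *m x)^t* *m A *m (P *m x).
Proof. by rewrite trmx_mul map_mxM !mulmxA. Qed.

Let cpd_diag (C : numClosedFieldType) (n : nat) (P : 'M[C]_n) (d : 'rV[C]_n) :
  P \in unitmx -> (forall i, 0 < d 0 i) -> cpd (P^t* *m diag_mx d *m P).
Proof.
move=> Pu dp x x0.
have Px0 : P *m x != 0.
  by apply: contra_neq x0 => /(congr1 (mulmx (invmx P))); rewrite mulKmx// mulmx0.
rewrite quadE.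
move: (P *m x) Px0 => y /matrix0Pn[i [j]]; rewrite ord1 => {j} yi.
rewrite mxE (bigD1 i)//= ltr_wpDr//; last first.
  by rewrite mul_mx_diag !mxE mulrAC -normCKC mulr_gt0// exprn_gt0// normr_gt0.
apply: sumr_ge0 => k _.
by rewrite mul_mx_diag !mxE mulrAC -normCKC mulr_ge0// ?exprn_ge0// ltW.
Qed.

Let toC_spd (R : realType) (n : nat) (W : 'M[R]_n) : spdmx W -> cpd (toC W).
Proof.
move=> [/is_hermitianmxP]; rewrite expr0 scale1r map_mx_id// => symW pW x x0.
pose a := map_mx (@complex.Re R) x; pose b := map_mx (@complex.Im R) x.
have xE : x = toC a + 'i%C *: toC b.
  by apply/matrixP => i j; rewrite !mxE -complexE.
have xJ : x^t* = toC a^T - 'i%C *: toC b^T.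
  apply/matrixP => i j; rewrite !mxE; case: (x j i) => p q.
  by rewrite /= -[Num.conj _]/(conjc _); simpc.
have ii : 'i%C * 'i%C = -1 :> R[i] by rewrite -expr2 sqr_i.
have comm (c d : 'cV[R]_n) : c^T *m W *m d = d^T *m W *m c.
  rewrite [LHS]mx11_scalar -tr_scalar_mx -mx11_scalar.
  by rewrite !trmx_mul trmxK -symW mulmxA.
have -> : x^t* *m toC W *m x = toC (a^T *m W *m a + b^T *m W *m b).
  rewrite xJ xE !mulmxDl !mulmxDr !mulNmx -!scalemxAl -!scalemxAr scalerA ii.
  rewrite map_mxD !map_mxM scaleN1r opprK.
  rewrite -!map_mxM (comm b a).
  by rewrite addrA addrK.
have pos0 (c : 'cV[R]_n) : 0 <= (c^T *m W *m c) 0 0.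
  by have [->|/pW/ltW//] := eqVneq c 0; rewrite mulmx0 mxE.
rewrite mxE (ltcR 0) mxE.
have [a0|/pW pa] := eqVneq a 0; last by rewrite ltr_wpDr.
have [b0|/pW pb] := eqVneq b 0; last by rewrite ltr_wpDl.
by move: x0; rewrite xE a0 b0 map_mx0 scaler0 addr0 eqxx.
Qed.

Lemma sqrtmx_exists (R : realType) (n : nat) (W : 'M[R]_n) :
  spdmx W -> exists V : 'M[R]_n, spdmx V /\ V *m V = W.
Proof.
move=> sW; have := sW => -[/is_hermitianmxP].
rewrite expr0 scale1r map_mx_id// => symW _.
have toCJ (m k : nat) (c : 'M[R]_(m, k)) : (toC c)^t* = toC c^T.
  apply/matrixP => i j; rewrite !mxE; apply/CrealP/complex_realP.
  by exists (c j i).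
have nW : toC W \is normalmx by apply/normalmxP; rewrite toCJ -symW.
set P := spectralmx (toC W); set d := spectral_diag (toC W).
have Pu : P \is unitarymx := spectral_unitarymx _.
have Pun : P \in unitmx := spectral_unit _.
have WE : toC W = P^t* *m diag_mx d *m P.
  by rewrite [LHS](orthomx_spectralP nW) invmx_unitary.
have dp i : 0 < d 0 i.
  have PP : P *m P^t* = 1%:M by apply/unitarymxP.
  pose x : 'cV_n := P^t* *m delta_mx i 0.
  have Px : P *m x = delta_mx i 0 by rewrite /x mulmxA PP mul1mx.
  have x0 : x != 0.
    apply/eqP => x0; move: Px; rewrite x0 mulmx0 => /matrixP/(_ i 0)/eqP.
    by rewrite !mxE !eqxx eq_sym oner_eq0.
  have := toC_spd sW x0; rewrite WE quadE Px mxE (bigD1 i)//= big1 => [|k ki].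
    by rewrite mul_mx_diag !mxE !eqxx conjC1 mulr1 mul1r addr0.
  by rewrite mxE [X in _ * X]mxE (negPf ki) mulr0.
pose e := map_mx sqrtC d; pose S := P^t* *m diag_mx e *m P.
have pS : cpd S by apply: cpd_diag => // i; rewrite mxE sqrtC_gt0.
have SS : S *m S = toC W.
  have PP : P *m P^t* = 1%:M by apply/unitarymxP.
  rewrite WE /S !mulmxA -(mulmxA _ P) PP mulmx1 -(mulmxA (P^t*)).
  rewrite mulmx_diag; congr (_ *m diag_mx _ *m _).
  by apply/rowP => k; rewrite !mxE -expr2 sqrtCK.
have Sh : S^t* = S.
  rewrite /S !trmx_mul !map_mxM trmxCK mulmxA; congr (_ *m _ *m _).
  rewrite tr_diag_mx map_diag_mx; congr diag_mx; apply/rowP => k; rewrite !mxE.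
  by apply/CrealP; rewrite ger0_real// sqrtC_ge0 ltW.
have conjK2 (m k : nat) (c : 'M[R[i]]_(m, k)) : cj (cj c) = c.
  by apply/matrixP => i j; rewrite !mxE conjCK.
have cjM (m k l : nat) (c : 'M[R[i]]_(m, k)) (c' : 'M[R[i]]_(k, l)) :
    cj (c *m c') = cj c *m cj c' by exact: map_mxM.
have SJ : cj S = S.
  apply: (@sqrt_unique_gen _ (Num.conj : {rmorphism R[i] -> R[i]})).
  - have : (map_mx Num.conj S)^t* = cj S by rewrite -{2}Sh map_trmx conjK2.
    by move=> h; rewrite linearB/= map_mxB h Sh.
  - move=> x x0.
    have y0 : cj x != 0.
      apply: contra_neq x0 => /(congr1 cj).
      by rewrite conjK2 map_mx0.
    suff -> : (x^t* *m (cj S) *m x) 0 0 =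
        Num.conj (((cj x)^t* *m S *m (cj x)) 0 0).
      by rewrite (geC0_conj (ltW (pS _ y0))); exact: (pS _ y0).
    rewrite [RHS](_ : _ = cj ((cj x)^t* *m S *m (cj x)) 0 0); last by rewrite [RHS]mxE.
    by rewrite !cjM !conjK2 map_trmx.
  - exact: pS.
  - rewrite -map_mxM SS; apply/matrixP => i j; rewrite !mxE.
    by apply/CrealP/complex_realP; exists (W i j).
have toC_inj (m k : nat) (c c' : 'M[R]_(m, k)) : toC c = toC c' -> c = c'.
  move=> /matrixP cc; apply/matrixP => i j.
  by have := cc i j; rewrite !mxE => /complexI.
pose V := map_mx (@complex.Re R) S.
have VE : toC V = S.
  apply/matrixP => i j; rewrite 2!mxE RRe_real//.
  by have /matrixP/(_ i j) := SJ; rewrite [LHS]mxE => /CrealP.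
exists V; split; last first.
  by apply: toC_inj; rewrite map_mxM VE SS.
split.
  apply/is_hermitianmxP; rewrite expr0 scale1r map_mx_id//.
  by apply: toC_inj; rewrite -toCJ VE Sh.
move=> x x0; have /pS : toC x != 0.
  by apply: contra_neq x0; rewrite -(map_mx0 (real_complex R)); exact: toC_inj.
by rewrite toCJ -VE -!map_mxM mxE (ltcR 0).
Qed.
End SqrtExists.

Lemma sqrtmxP (R : realType) (n : nat) (W : 'M[R]_n) :
  spdmx W -> spdmx (sqrtmx W) /\ sqrtmx W *m sqrtmx W = W.
Proof. by move=> /sqrtmx_exists; exact: xgetPex. Qed.

Lemma specnorm_has_sup (R : realType) (m n : nat) (A : 'M[R[i]]_(m, n)) :
  has_sup [set cvnorm2 (A *m v) |
             v in [set v : 'cV[R[i]]_n | cvnorm2 v <= 1]]%classic.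
Proof.
have nge0 (x : R[i]) : 0 <= ComplexField.Normc.normc x.
  by case: x => a b; exact: sqrtr_ge0.
split.
  exists (cvnorm2 (A *m 0)), 0 => //=.
  rewrite /cvnorm2 big1 ?sqrtr0// => i _.
  by rewrite mxE ComplexField.Normc.normc0 expr0n.
exists (Num.sqrt (\sum_i (\sum_j ComplexField.Normc.normc (A i j)) ^+ 2)).
move=> _ [v /= v1 <-].
rewrite /cvnorm2 ler_wsqrtr// ler_sum// => i _.
rewrite lerXn2r ?nnegrE ?sumr_ge0// mxE.
have leD : forall s : seq 'I_n,
    ComplexField.Normc.normc (\sum_(j <- s) A i j * v j 0) <=
    \sum_(j <- s) ComplexField.Normc.normc (A i j * v j 0).
  elim=> [|j s IH]; first by rewrite !big_nil ComplexField.Normc.normc0.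
  by rewrite !big_cons (le_trans (le_normcD _ _))// lerD2l.
apply: (le_trans (leD _)); apply: ler_sum => j _.
rewrite ComplexField.Normc.normcM ler_piMr//.
apply: le_trans v1; rewrite -[leLHS]ger0_norm// -sqrtr_sqr ler_wsqrtr//.
by rewrite (bigD1 j)//= lerDl sumr_ge0// => k _; rewrite sqr_ge0.
Qed.

(* Main.v *)
(** Positive semi-definiteness of the block matrix, applied to [(u, v)], reads
    [|v|_W^2 - |u|_W^2 >= 2 <G u, B v - u>_Z]; summing over real and imaginary
    parts gives the same bound, with [Re] on the right, for complex vectors.
    If [(1 - z G) u = B v] then [B v - u = - z G u], so the right-hand side is
    [- 2 Re z |G u|_Z^2 >= 0] and [|u|_W <= |v|_W]. The case [v = 0] shows that
    [1 - z G] is injective. *)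
Require Import Defs.
From mathcomp Require Import all_boot all_order all_algebra.
From mathcomp Require Import reals complex.
From mathcomp Require Import sesquilinear.
From mathcomp Require Import ring lra.
Set Implicit Arguments.
Unset Strict Implicit.
Unset Printing Implicit Defensive.
Import Order.TTheory GRing.Theory Num.Theory.
Local Open Scope ring_scope.

Notation ReM := (map_mx (@complex.Re _)).
Notation ImM := (map_mx (@complex.Im _)).

(** A square matrix with trivial kernel is invertible; [inj_row_free] speaks of row vectors, hence
    the passage through the transpose. *)
Lemma unitmx_inj_col (F : fieldType) (n : nat) (A : 'M[F]_n) :
  (forall u : 'cV[F]_n, A *m u = 0 -> u = 0) -> A \in unitmx.
Proof.
move=> Ainj; rewrite -unitmx_tr -row_free_unit; apply: inj_row_free => v vA0.
apply: trmx_inj; rewrite trmx0; apply: Ainj.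
by rewrite -[A]trmxK -trmx_mul vA0 trmx0.
Qed.

Section BilinearForm.
Variable R : realType.
Implicit Types (n : nat) (z : R[i]).

Definition bform n (A : 'M[R]_n) (x y : 'cV[R]_n) : R := (x^T *m A *m y) 0 0.

Lemma bformDr n (A : 'M[R]_n) x y1 y2 :
  bform A x (y1 + y2) = bform A x y1 + bform A x y2.
Proof. by rewrite /bform mulmxDr mxE. Qed.

Lemma bformZr n (A : 'M[R]_n) x k y : bform A x (k *: y) = k * bform A x y.
Proof. by rewrite /bform -scalemxAr mxE. Qed.

Lemma bformBr n (A : 'M[R]_n) x y1 y2 :
  bform A x (y1 - y2) = bform A x y1 - bform A x y2.
Proof. by rewrite bformDr -scaleN1r bformZr mulN1r. Qed.

Lemma symmetricmx_tr n (A : 'M[R]_n) : A \is symmetricmx -> A^T = A.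
Proof. by move=> /is_hermitianmxP; rewrite expr0 scale1r map_mx_id. Qed.

Lemma bformC n (A : 'M[R]_n) x y : A \is symmetricmx -> bform A x y = bform A y x.
Proof.
move=> /symmetricmx_tr symA; rewrite /bform.
by rewrite -[x^T *m A *m y]trmxK [LHS]mxE !trmx_mul trmxK symA mulmxA.
Qed.

Lemma spdmx_bform_ge0 n (A : 'M[R]_n) x : spdmx A -> 0 <= bform A x x.
Proof.
move=> [_ pA]; have [->|/pA/ltW//] := eqVneq x 0.
by rewrite /bform mulmx0 mxE.
Qed.

Lemma spdmx_bform_eq0 n (A : 'M[R]_n) x : spdmx A -> bform A x x = 0 -> x = 0.
Proof.
move=> [_ pA] x0; apply/eqP; apply: contraT => /pA.
by rewrite -/(bform A x x) x0 ltxx.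
Qed.

Lemma spdmx_unit n (A : 'M[R]_n) : spdmx A -> A \in unitmx.
Proof.
move=> sA; apply: unitmx_inj_col => u Au0; apply: (spdmx_bform_eq0 sA).
by rewrite /bform -mulmxA Au0 mulmx0 mxE.
Qed.

Lemma ReM_mul n (A : 'M[R]_n) (v : 'cV[R[i]]_n) : ReM (toC A *m v) = A *m ReM v.
Proof.
apply/matrixP => i j; rewrite !mxE raddf_sum; apply: eq_bigr => k _.
by rewrite !mxE; case: (v k j) => a b /=; rewrite mul0r subr0.
Qed.

Lemma ImM_mul n (A : 'M[R]_n) (v : 'cV[R[i]]_n) : ImM (toC A *m v) = A *m ImM v.
Proof.
apply/matrixP => i j; rewrite !mxE raddf_sum; apply: eq_bigr => k _.
by rewrite !mxE; case: (v k j) => a b /=; rewrite mul0r addr0.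
Qed.

Lemma ReM_scale n z (v : 'cV[R[i]]_n) :
  ReM (z *: v) = complex.Re z *: ReM v - complex.Im z *: ImM v.
Proof. by apply/matrixP => i j; rewrite !mxE; case: z (v i j) => x y []. Qed.

Lemma ImM_scale n z (v : 'cV[R[i]]_n) :
  ImM (z *: v) = complex.Re z *: ImM v + complex.Im z *: ReM v.
Proof.
apply/matrixP => i j; rewrite !mxE; case: z (v i j) => x y [] a b /=.
by rewrite (mulrC y a).
Qed.

Lemma ReM_ImM_eq0 n (v : 'cV[R[i]]_n) : ReM v = 0 -> ImM v = 0 -> v = 0.
Proof.
move=> /matrixP Re0 /matrixP Im0; apply/matrixP => i j.
move: (Re0 i j) (Im0 i j); rewrite !mxE; case: (v i j) => a b /= -> ->.
by [].
Qed.

(* The Hermitian form [v^* W v] of a real symmetric [W]. *)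
Definition hform n (W : 'M[R]_n) (v : 'cV[R[i]]_n) : R :=
  bform W (ReM v) (ReM v) + bform W (ImM v) (ImM v).

Lemma spdmx_hform_le0 n (W : 'M[R]_n) v : spdmx W -> hform W v <= 0 -> v = 0.
Proof.
move=> sW; rewrite /hform => le0.
have Rege0 := spdmx_bform_ge0 (ReM v) sW; have Imge0 := spdmx_bform_ge0 (ImM v) sW.
by apply: ReM_ImM_eq0; apply: (spdmx_bform_eq0 sW); lra.
Qed.

(** Turns the weighted Euclidean norm into the Hermitian form of [W]: the root [V] is symmetric with
    [V *m V = W], so [x^T *m W *m x] is the squared length of [V *m x], and [V], being real, acts
    separately on real and imaginary parts. *)
Lemma cvnorm2_sqrtmx n (W : 'M[R]_n) (v : 'cV[R[i]]_n) :
  spdmx W -> cvnorm2 (toC (sqrtmx W) *m v) = Num.sqrt (hform W v).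
Proof.
move=> /sqrtmxP[[/symmetricmx_tr symV _] VV]; rewrite /cvnorm2; congr Num.sqrt.
have bformW x : bform W x x = \sum_i (sqrtmx W *m x) i 0 ^+ 2.
  rewrite /bform -{1}VV -{1}symV mulmxA -mulmxA -trmx_mul mxE.
  by apply: eq_bigr => i _; rewrite expr2 mxE.
rewrite /hform !bformW -big_split/=; apply: eq_bigr => i _.
rewrite -ReM_mul -ImM_mul !mxE; case: (\sum_j _) => a b /=.
by rewrite sqr_sqrtr// addr_ge0 ?sqr_ge0.
Qed.

End BilinearForm.

Section Contraction.
Variables (R : realType) (s : nat) (B G W Z : 'M[R]_s).
Hypotheses (sW : spdmx W) (sZ : spdmx Z).
Hypothesis psdM :
  psdmx (block_mx (G^T *m Z + Z *m G - W) (- (G^T *m Z *m B))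
                  (- (B^T *m Z *m G)) W).

Lemma psd_block_dissipation (u v : 'cV[R]_s) :
  2 * bform Z (G *m u) (B *m v - u) <= bform W v v - bform W u u.
Proof.
have symZ := symmetricmx_tr sZ.1.
have := psdM.2 (col_mx u v).
rewrite tr_col_mx mul_row_block mul_row_col.
rewrite !(mulmxDl, mulmxDr, mulmxN, mulNmx).
have e1 : u^T *m (G^T *m Z) *m u = (G *m u)^T *m Z *m u.
  by rewrite trmx_mul !mulmxA.
have e2 : u^T *m (Z *m G) *m u = u^T *m Z *m (G *m u) by rewrite !mulmxA.
have e3 : v^T *m (B^T *m Z *m G) *m u = (B *m v)^T *m Z *m (G *m u).
  by rewrite trmx_mul !mulmxA.
have e4 : u^T *m (G^T *m Z *m B) *m v = (G *m u)^T *m Z *m (B *m v).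
  by rewrite trmx_mul !mulmxA.
(* Entrywise rules for sums and opposites only: a bare [mxE] would also unfold the products and hide
   the bilinear forms. *)
have addE (p q : 'M[R]_1) : (p + q) 0 0 = p 0 0 + q 0 0 by rewrite mxE.
have oppE (p : 'M[R]_1) : (- p) 0 0 = - p 0 0 by rewrite mxE.
rewrite e1 e2 e3 e4 !(addE, oppE) -!/(bform _ _ _).
(* Symmetry of [Z] moves [G *m u] to the left in every mixed term; the terms then pair up, which
   gives the factor 2. *)
rewrite (bformC u _ sZ.1) (bformC (B *m v) _ sZ.1) bformBr.
lra.
Qed.

Lemma hform_contraction z (u v : 'cV[R[i]]_s) : complex.Re z <= 0 ->
  (1%:M - z *: toC G) *m u = toC B *m v -> hform W u <= hform W v.
Proof.
move=> z_le0; rewrite mulmxBl mul1mx -scalemxAl => uv.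
have {}uv : toC B *m v - u = - (z *: (toC G *m u)) by rewrite -uv addrAC subrr add0r.
(* [B] and [G] are real, so the complex relation splits into two real ones, coupled only through
   [complex.Im z]. *)
have Reuv : B *m ReM v - ReM u =
    - (complex.Re z *: (G *m ReM u) - complex.Im z *: (G *m ImM u)).
  by rewrite -!ReM_mul -ImM_mul -ReM_scale -map_mxB uv map_mxN.
have Imuv : B *m ImM v - ImM u =
    - (complex.Re z *: (G *m ImM u) + complex.Im z *: (G *m ReM u)).
  by rewrite -!ImM_mul -ReM_mul -ImM_scale -map_mxB uv map_mxN.
have := psd_block_dissipation (ReM u) (ReM v).
have := psd_block_dissipation (ImM u) (ImM v).
rewrite Reuv Imuv -!scaleN1r !bformZr !bformDr -?scaleN1r !bformZr.
(* The two terms in [complex.Im z] carry opposite signs and cancel once the real and imaginary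
   inequalities are added. *)
rewrite (bformC (G *m ImM u) (G *m ReM u) sZ.1) /hform.
have := mulr_le0_ge0 z_le0 (spdmx_bform_ge0 (G *m ReM u) sZ).
have := mulr_le0_ge0 z_le0 (spdmx_bform_ge0 (G *m ImM u) sZ).
lra.
Qed.

Lemma unit_sub_scale z : complex.Re z <= 0 -> 1%:M - z *: toC G \in unitmx.
Proof.
move=> z_le0; apply: unitmx_inj_col => u u0; apply: (spdmx_hform_le0 sW).
suff <- : hform W 0 = 0.
  by apply: (hform_contraction z_le0); rewrite u0 mulmx0.
by rewrite /hform !raddf0 /bform !mulmx0 mxE addr0.
Qed.

End Contraction.

Theorem lemma2p8 (R : realType) (s : nat) (B G W Z : 'M[R]_s) :
  spdmx W -> spdmx Z ->
  psdmx (block_mx (G^T *m Z + Z *m G - W) (- (G^T *m Z *m B))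
                  (- (B^T *m Z *m G))     W) ->
  forall z : R[i], complex.Re z < 0 ->
    1%:M - z *: toC G \in unitmx /\
    specnorm (toC (sqrtmx W) *m stabmx B G z *m toC (invmx (sqrtmx W))) <= 1.
Proof.
move=> sW sZ psdM z /ltW z_le0.
(* This makes the total function [invmx] a genuine inverse inside [stabmx]. *)
have unitS := unit_sub_scale sW sZ psdM z_le0; split=> //.
have unitV : sqrtmx W \in unitmx by have [/spdmx_unit] := sqrtmxP sW.
apply: ge_sup => [|_ [w /= w1 <-]]; first exact: (specnorm_has_sup _).1.
apply: le_trans w1; rewrite /stabmx -!mulmxA.
(* In the variable [v] both sides are norms weighted by [sqrtmx W], so the claim compares [hform W]
   at [stabmx B G z *m v] and at [v]. *)
set v := toC (invmx (sqrtmx W)) *m w.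
have -> : w = toC (sqrtmx W) *m v.
  by rewrite /v mulmxA -map_mxM mulmxV// map_mx1 mul1mx.
rewrite !cvnorm2_sqrtmx// ler_wsqrtr//.
apply: (hform_contraction sZ psdM z_le0).
by rewrite mulKVmx.
Qed.
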